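(* Let $p,q$ be integers and let $r,s$ be nonzero integers. For all integers $n\ge 0$, $m\ge 1$ and $l\in\{0,1,\dots,m-1\}$, $$H(p,q;r,s;\,mn+l)=H\bigl(H(p,q;r,s;l),\,H(p,q;r,s;m+l);\ SUM(r,s;m),\,-(-s)^m;\ n\bigr),$$ where $$SUM(r,s;m)=r^m\sum_{k=0}^{\lfloor m/2\rfloor}T(m,k)\,\left(\frac{s}{r^2}\right)^k .$$
   Context: For given $p,q,r,s$, the (Horadam) sequence $H(p,q;r,s;n)$, $n\ge 0$, is defined by $H(p,q;r,s;0)=p$, $H(p,q;r,s;1)=q$ and $H(p,q;r,s;n)=r\,H(p,q;r,s;n-1)+s\,H(p,q;r,s;n-2)$ for $n\ge 2$; $(p,q)$ are called the seeds and $(r,s)$ the signature. $T(n,k)$ is the irregular triangle OEIS A034807: $T(0,0)=2$ and $T(n,k)=\frac{n\,(n-1-k)!}{k!\,(n-2k)!}$ for $n\ge 1$ and $0\le k\le\lfloor n/2\rfloor$. *)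

(* Defs.v *)
From mathcomp Require Import all_boot all_order all_algebra.
Set Implicit Arguments.
Unset Strict Implicit.
Unset Printing Implicit Defensive.
Import GRing.Theory.
Local Open Scope ring_scope.

(* Generic in the ring: the original sequence is integral, whereas the
   signature of the extracted subsequence contains the quantity SUM, which is
   defined through a rational expression. *)
Fixpoint horadam (R : comPzRingType) (p q r s : R) (n : nat) : R :=
  match n with
  | 0 => p
  | n1.+1 =>
      match n1 with
      | 0 => q
      | n2.+1 => r * horadam p q r s n1 + s * horadam p q r s n2
      end
  end.

(* OEIS A034807. Only the entries with k <= n./2 are meaningful; for n >= 1
   no natural-number subtraction below truncates in that range. *)
Definition T (n k : nat) : rat :=
  if n == 0%N then 2
  else (n * (n - 1 - k)`!)%:R / (k`! * (n - 2 * k)`!)%:R.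

Definition SUM (r s : int) (m : nat) : rat :=
  r%:~R ^+ m * \sum_(0 <= k < (m./2).+1) T m k * (s%:~R / r%:~R ^+ 2) ^+ k.

(* Main.v *)
(* Let V_m be the Lucas-type sequence with seeds (2, r) and signature (r, s).
   Induction on m gives h(2m + k) = V_m h(m + k) - (-s)^m h(k) for every
   Horadam sequence h of signature (r, s), so the subsequence h(mn + l) has
   signature (V_m, -(-s)^m).  That V_m = SUM(r, s; m) follows, after dividing
   by r^m and putting x = s / r^2, from the Pascal recurrence of the Fibonacci
   polynomials F_n = sum_k C(n-k, k) x^k: both sides at n + 1 are
   2 F_(n+1) - F_n. *)
Require Import Defs.
From mathcomp Require Import all_boot all_order all_algebra.
From mathcomp Require Import ring zify.
Set Implicit Arguments.
Unset Strict Implicit.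
Unset Printing Implicit Defensive.
Import GRing.Theory.
Local Open Scope ring_scope.

Lemma nat_ind2 (P : nat -> Prop) :
  P 0%N -> P 1%N -> (forall n, P n -> P n.+1 -> P n.+2) -> forall n, P n.
Proof.
move=> P0 P1 PS n; suff [] : P n /\ P n.+1 by [].
by elim: n => [|n [Pn PSn]]; split=> //; exact: PS.
Qed.

Section HoradamTheory.
Variable R : comNzRingType.
Implicit Types p q r s x : R.

Lemma horadamSS p q r s n :
  horadam p q r s n.+2 = r * horadam p q r s n.+1 + s * horadam p q r s n.
Proof. by []. Qed.

Lemma horadam_unique (h : nat -> R) r s :
    (forall n, h n.+2 = r * h n.+1 + s * h n) ->
  forall n, h n = horadam (h 0%N) (h 1%N) r s n.
Proof.
move=> hSS; elim/nat_ind2=> // n IHn IHn1.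
by rewrite hSS horadamSS -IHn -IHn1.
Qed.

Lemma rmorph_horadam (S : comNzRingType) (f : {rmorphism R -> S}) p q r s n :
  f (horadam p q r s n) = horadam (f p) (f q) (f r) (f s) n.
Proof.
elim/nat_ind2: n => // n IHn IHn1.
by rewrite !horadamSS rmorphD !rmorphM IHn IHn1.
Qed.

(** Weighted homogeneity, with [q], [r] of weight 1 and [s] of weight 2. Taking c = r carries the
    signature (1, s / r^2) to (r, s). *)
Lemma horadam_scale p q r s c n :
  horadam p (c * q) (c * r) (c ^+ 2 * s) n = c ^+ n * horadam p q r s n.
Proof.
elim/nat_ind2: n => [||n IHn IHn1]; rewrite ?expr0 ?mul1r ?expr1 //.
rewrite !horadamSS IHn IHn1 !exprS; ring.
Qed.

(** If a, b are the roots of t^2 = r t + s, then a b = -s and this is a^(2m) = (a^m + b^m) a^m - (a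
    b)^m; induction avoids adjoining roots. *)
Lemma horadam_lucas p q r s m k :
  horadam p q r s (m + m + k)%N =
  horadam 2 r r s m * horadam p q r s (m + k)%N
    - (- s) ^+ m * horadam p q r s k.
Proof.
elim/nat_ind2: m k => [k|k|m IHm IHm1 k].
- rewrite !add0n expr0 /=; ring.
- rewrite !(addSn, add0n) expr1 /=; ring.
have -> : (m.+2 + m.+2 + k = (m + m + k).+4)%N by lia.
(* These shifts of [k] give both hypotheses the common factor h(m + 2 + k). *)
have := IHm k.+2; have := IHm1 k.+1.
have -> : (m.+1 + m.+1 + k.+1 = (m + m + k).+3)%N by lia.
have -> : (m + m + k.+2 = (m + m + k).+2)%N by lia.
have -> : (m.+1 + k.+1 = m.+2 + k)%N by lia.
have -> : (m + k.+2 = m.+2 + k)%N by lia.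
rewrite (horadamSS 2 r) (horadamSS _ _ _ _ (m + m + k).+2) => -> ->.
rewrite (horadamSS _ _ _ _ k) !exprS; ring.
Qed.

Lemma horadam_arith_prog p q r s m l n :
  horadam p q r s (m * n + l)%N =
  horadam (horadam p q r s l) (horadam p q r s (m + l)%N)
    (horadam 2 r r s m) (- (- s) ^+ m) n.
Proof.
rewrite (@horadam_unique (fun n => horadam p q r s (m * n + l)%N)
  (horadam 2 r r s m) (- (- s) ^+ m)) ?muln0 ?muln1 //= => {}n.
have -> : (m * n.+2 + l = m + m + (m * n + l))%N by lia.
have -> : (m * n.+1 + l = m + (m * n + l))%N by lia.
by rewrite horadam_lucas mulNr.
Qed.

(** Terms with 2k > n vanish; summing up to [n] avoids parity cases. *)
Definition fib_poly x n : R := \sum_(0 <= k < n.+1) 'C(n - k, k)%:R * x ^+ k.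

Lemma fib_polySS x n : fib_poly x n.+2 = fib_poly x n.+1 + x * fib_poly x n.
Proof.
rewrite /fib_poly [in LHS]big_nat_recl // [in RHS]big_nat_recl //.
(* The top term C(0, n+2) is zero; without it the ranges agree and Pascal's rule applies
   termwise. *)
rewrite [in LHS]big_nat_recr //= subnn bin0n mul0r addr0 -addrA.
rewrite mulr_sumr -big_split /=; congr (_ + _).
apply: eq_big_nat => k /andP[_ ltkn]; rewrite !subSS subSn // binS.
rewrite natrD !exprS; ring.
Qed.

Lemma horadam_fib_poly x n :
  horadam 2 1 1 x n.+1 = 2 * fib_poly x n.+1 - fib_poly x n.
Proof.
have F0 : fib_poly x 0 = 1 by rewrite /fib_poly big_nat1 expr0 mulr1.
have F1 : fib_poly x 1 = 1.
  by rewrite /fib_poly big_nat_recr //= big_nat1 expr0 mulr1 mul0r addr0.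
elim/nat_ind2: n => [||n IHn IHn1].
- rewrite F0 F1 /=; ring.
- rewrite fib_polySS F0 F1 /=; ring.
rewrite horadamSS IHn IHn1 (fib_polySS x n.+1) (fib_polySS x n); ring.
Qed.

End HoradamTheory.

(** Multiplied by k! (n+1-2k)!, both sides are multiples of (n-k)!, and 2(n+1-k) - (n+1-2k) =
    n+1. *)
Lemma T_bin n k : (k.*2 <= n.+1)%N ->
  T n.+1 k = 2 * 'C(n.+1 - k, k)%:R - 'C(n - k, k)%:R.
Proof.
move=> le2k; rewrite /T /= subSS subn0.
have -> : (n.+1 - 2 * k = n.+1 - k - k)%N by lia.
have fact_bin1 : ('C(n.+1 - k, k) * (k`! * (n.+1 - k - k)`!)
                  = (n.+1 - k) * (n - k)`!)%N.
  by rewrite bin_fact ?[(n.+1 - k)%N]subSn ?factS //; lia.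
have fact_bin0 : ('C(n - k, k) * (k`! * (n.+1 - k - k)`!)
                  = (n.+1 - k - k) * (n - k)`!)%N.
  (* Here n - k < k forces 2k = n+1, so both sides are zero. *)
  have [ltnk|lekn] := ltnP (n - k) k.
    by rewrite bin_small // (_ : n.+1 - k - k = 0)%N //; lia.
  have -> : (n.+1 - k - k = (n - k - k).+1)%N by lia.
  by rewrite factS -(bin_fact lekn); ring.
have D0 : (k`! * (n.+1 - k - k)`!)%:R != 0 :> rat.
  by rewrite Num.Theory.pnatr_eq0 -lt0n muln_gt0 !fact_gt0.
apply: (mulIf D0); rewrite mulfVK // mulrBl -mulrA -!natrM fact_bin1 fact_bin0.
rewrite -natrB; last by rewrite mulnA leq_mul2r; lia.
congr (_%:R); rewrite mulnA -mulnBl; congr (_ * _)%N; lia.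
Qed.

Lemma T_sum_lucas (x : rat) m :
  \sum_(0 <= k < (m./2).+1) T m k * x ^+ k = horadam 2 1 1 x m.
Proof.
case: m => [|n]; first by rewrite big_nat1 expr0 mulr1.
rewrite horadam_fib_poly /fib_poly.
(* Padding by a zero term lets the two sums share one range. *)
have -> : \sum_(0 <= k < n.+1) 'C(n - k, k)%:R * x ^+ k
        = \sum_(0 <= k < n.+2) 'C(n - k, k)%:R * x ^+ k.
  by rewrite [RHS]big_nat_recr //= bin_small ?mul0r ?addr0 //; lia.
rewrite mulr_sumr -sumrB [RHS](@big_cat_nat _ _ _ (n.+1)./2.+1) //=; last by lia.
rewrite [X in _ = _ + X]big_nat_cond [X in _ = _ + X]big1 ?addr0; last first.
  by move=> k ?; rewrite !bin_small ?mul0r ?mulr0 ?subr0 //; lia.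
apply: eq_big_nat => k ?; rewrite T_bin ?mulrBl ?mulrA //; lia.
Qed.

Lemma SUM_lucas (r s : int) m : r != 0 ->
  SUM r s m = horadam 2 r%:~R r%:~R s%:~R m.
Proof.
move=> r0; rewrite /SUM T_sum_lucas -horadam_scale mulr1 mulrC mulfVK //.
by rewrite expf_neq0 // intr_eq0.
Qed.

Theorem mainTheorem2 (p q r s : int) (hr : r != 0) (hs : s != 0)
    (n m l : nat) (hm : (1 <= m)%N) (hl : (l < m)%N) :
  (horadam p q r s (m * n + l)%N)%:~R =
  horadam (horadam p q r s l)%:~R (horadam p q r s (m + l)%N)%:~R
    (SUM r s m) (- (- s) ^+ m)%:~R n :> rat.
Proof.
rewrite SUM_lucas // horadam_arith_prog.
rewrite (rmorph_horadam (intr : {rmorphism int -> rat})) /=.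
(* The integer V_m inside the signature must also be carried to the rationals. *)
by rewrite (rmorph_horadam (intr : {rmorphism int -> rat}) 2) /=.
Qed.
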